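(* Let $\alpha=(\alpha_1,\dots,\alpha_n)$ be a composition and let $m$ be an integer with $1\le m<n$. Then the skew diagram $\delta_\alpha/(m)$ is a sum of fat staircases if and only if $\alpha_j>1$ for each $j=1,2,\dots,n-1$.
   Context: A composition $\alpha=(\alpha_1,\dots,\alpha_n)$ is a finite sequence of positive integers. $\delta_\alpha=(n^{\alpha_n},(n-1)^{\alpha_{n-1}},\dots,1^{\alpha_1})$ is the partition with exactly $\alpha_i$ parts equal to $i$ for each $i=1,\dots,n$. A partition $\nu$ is a fat staircase if $\nu=\delta_\beta$ for some composition $\beta$. A skew diagram $D=\rho/\kappa$ is called a sum of fat staircases if in the Schur expansion $s_D=\sum_\nu c_{\kappa\nu}^{\rho}s_\nu$ of its skew Schur function ($c_{\kappa\nu}^\rho$ the Littlewood-Richardson coefficients) we have $c_{\kappa\nu}^{\rho}=0$ for every partition $\nu$ that is not a fat staircase. $(m)$ is the one-row partition with $m$ boxes. *)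

(* Defs.v *)
From HB Require Import structures.
From mathcomp Require Import all_boot all_order all_algebra.
From mathcomp Require Import finmap mpoly.

Set Implicit Arguments.
Unset Strict Implicit.
Unset Printing Implicit Defensive.

Import GRing.Theory.
Local Open Scope ring_scope.

Definition is_partition (s : seq nat) : bool := sorted geq s && (0%N \notin s).

Record intpart := IntPart {
  parts :> seq nat;
  _ : is_partition parts
}.

HB.instance Definition _ := [isSub for parts].
HB.instance Definition _ := [Choice of intpart by <:].

Definition is_composition (a : seq nat) : bool := 0%N \notin a.

(* alpha is indexed from 0 in Rocq, so alpha_i is nth 0 alpha i.-1. *)
Definition delta (alpha : seq nat) : seq nat :=
  flatten [seq nseq (nth 0%N alpha i.-1) i | i <- rev (iota 1 (size alpha))].

Definition fat_staircase (nu : seq nat) : Prop :=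
  exists2 beta : seq nat, is_composition beta & nu = delta beta.

(* Row i of rho / kappa occupies the columns kappa_i <= j < rho_i, with rows
   and columns numbered from 0 and rows listed from top to bottom.  This is the
   skew diagram rho / kappa when kappa is contained in rho. *)
Definition in_skew (rho kappa : seq nat)
    (x : 'I_(size rho) * 'I_(head 0%N rho)) : bool :=
  (nth 0 kappa x.1 <= x.2 < nth 0 rho x.1)%N.

Definition cell (rho kappa : seq nat) : finType :=
  {x : 'I_(size rho) * 'I_(head 0%N rho) | in_skew kappa x}.

Definition ssyt (N : nat) (rho kappa : seq nat)
    (T : {ffun cell rho kappa -> 'I_N}) : bool :=
  [forall u : cell rho kappa, forall v : cell rho kappa,
     (((val u).1 == (val v).1) && ((val u).2 < (val v).2)%N ==> (T u <= T v)%N)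
  && (((val u).2 == (val v).2) && ((val u).1 < (val v).1)%N ==> (T u < T v)%N)].

(* The specialisation of the skew Schur function s_(rho / kappa) to the
   variables x_0, ..., x_(N-1). *)
Definition skew_schur (N : nat) (rho kappa : seq nat) : {mpoly int[N]} :=
  \sum_(T : {ffun cell rho kappa -> 'I_N} | ssyt T)
    \prod_(u : cell rho kappa) 'X_(T u).

Definition schur (N : nat) (nu : seq nat) : {mpoly int[N]} := skew_schur N nu [::].

(* c is the family of coefficients c^rho_(kappa, nu) of the Schur expansion of
   s_(rho / kappa).  An identity between symmetric functions is an identity
   between their specialisations to N variables for every N.  Since the Schur
   functions are linearly independent, there is at most one such c. *)
Definition schur_expansion (rho kappa : seq nat)
    (c : {fsfun intpart -> int with 0}) : Prop :=
  forall N : nat,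
    skew_schur N rho kappa = \sum_(nu <- finsupp c) c nu *: schur N nu.

Definition sum_of_fat_staircases (rho kappa : seq nat) : Prop :=
  exists2 c : {fsfun intpart -> int with 0},
    schur_expansion rho kappa c &
    forall nu : intpart, ~ fat_staircase nu -> c nu = 0.

(* Main.v *)
(* Removing a horizontal strip of size m commutes with removing a horizontal
   strip weighted by a variable x: between two fixed shapes, the intermediate
   shapes have their rows ranging independently over intervals, and reflecting
   each row in its interval exchanges the two strip sizes.  A tableau is a chain
   of horizontal strips, so s_(rho/(m)), a sum over chains from the empty shape
   to rho whose first step has size m, equals the sum over chains whose last
   step has size m, i.e. the sum of the s_nu with rho/nu a horizontal strip of
   size m.  Schur functions are linearly independent because the content of the
   tableau whose row i is filled with i occurs only in s_mu with mu = nu or with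
   a smaller sum of i mu_i.

   A partition is a fat staircase iff consecutive parts (including a final 0)
   differ by at most 1.  Removing a horizontal strip from delta_alpha creates a
   gap of 2 only around a part j < n of multiplicity alpha_j = 1, when j is
   shortened and the parts j+1 are kept; if such a j exists, the other corners
   can be chosen so that the strip has size m, as 1 <= m <= n-1. *)
From HB Require Import structures.
From mathcomp Require Import all_boot all_order all_algebra.
From mathcomp Require Import finmap mpoly zify.
Require Import Defs.

Set Implicit Arguments.
Unset Strict Implicit.
Unset Printing Implicit Defensive.

Import GRing.Theory.
Local Open Scope ring_scope.

(** * Horizontal strips *)

Section HorizontalStrips.
Variables l W : nat.
Notation shape := {ffun 'I_l.+1 -> 'I_W.+1}.
Implicit Types s t u v : shape.

(** Rows beyond the last one have length 0, so that [i.+1] can be used freely as a row index. *)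
Definition row v (i : nat) : nat := if insub i is Some j then v j else 0%N.

Definition boxes v : nat := (\sum_(i < l.+1) v i)%N.

(** Interlacing of the inner shape [s] with the outer shape [t]; it forces both shapes to be weakly
    decreasing. *)
Definition hstrip s t : bool :=
  [forall i : 'I_l.+1, (row t i.+1 <= s i <= t i)%N].

Lemma row_ord v (i : 'I_l.+1) : row v i = v i.
Proof. by rewrite /row valK. Qed.

Lemma row_out v i : (l < i)%N -> row v i = 0%N.
Proof. by move=> li; rewrite /row insubF // ltnS leqNgt li. Qed.

Lemma row_leW v i : (row v i <= W)%N.
Proof. by rewrite /row; case: insubP => // j _ _; rewrite -ltnS. Qed.

Lemma row_inj s t : (forall i, row s i = row t i) -> s = t.
Proof. by move=> st; apply/ffunP => i; apply/val_inj; rewrite /= -!row_ord st. Qed.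

Lemma hstripP s t :
  reflect (forall i, row t i.+1 <= row s i <= row t i)%N (hstrip s t).
Proof.
apply: (iffP forallP) => st i; last by have := st i; rewrite !row_ord.
case: (ltnP i l.+1) => il; first by have := st (Ordinal il); rewrite -!row_ord.
by rewrite !row_out // ltnW.
Qed.

Lemma boxesE v : boxes v = (\sum_(i < l.+1) row v i)%N.
Proof. by apply: eq_bigr => i _; rewrite row_ord. Qed.

(* The shapes between s and t in a two-step chain of horizontal strips are
   those whose i-th row lies between strip_min s t i and strip_max s t i,
   independently for each i. *)
Definition strip_min s t (i : nat) : nat := maxn (row s i) (row t i.+1).
Definition strip_max s t (i : nat) : nat :=
  if i is j.+1 then minn (row t i) (row s j) else row t 0.

Lemma hstrip2P s t u :
  reflect (forall i, i < l.+1 -> strip_min s t i <= row u i <= strip_max s t i)%N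
    (hstrip s u && hstrip u t).
Proof.
apply: (iffP andP) => [[/hstripP su /hstripP ut] i _ | stu].
  rewrite /strip_min /strip_max geq_max.
  case: i => [|i]; have := su 0%N; have := ut 0%N; first lia.
  by have := su i; have := su i.+1; have := ut i.+1; lia.
have bnd i : (strip_min s t i <= row u i <= strip_max s t i)%N.
  case: (ltnP i l.+1) => [/stu //|li].
  rewrite /strip_min !row_out //; last exact: ltnW.
split; apply/hstripP => i.
  by have := bnd i; have := bnd i.+1; rewrite /strip_min /strip_max /=; lia.
by have := bnd i; rewrite /strip_min /strip_max; case: i => [|i] /=; lia.
Qed.

Lemma strip_max_leW s t i : (strip_max s t i <= W)%N.
Proof.
by case: i => [|i] /=; rewrite ?geq_min ?row_leW.
Qed.

(** The Bender-Knuth involution, acting on the middle row of three consecutive rows of a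
    Gelfand-Tsetlin pattern. *)
Definition strip_reflect s t u : shape :=
  [ffun i : 'I_l.+1 => inord (strip_min s t i + strip_max s t i - u i)].

Lemma row_strip_reflect s t u i : (i < l.+1)%N -> hstrip s u && hstrip u t ->
  row (strip_reflect s t u) i = (strip_min s t i + strip_max s t i - row u i)%N.
Proof.
move=> il /hstrip2P/(_ i il) stu; rewrite -[i]/(val (Ordinal il)) !row_ord ffunE inordK //=.
by have := strip_max_leW s t i; move: stu; rewrite -[i]/(val (Ordinal il)) !row_ord /=; lia.
Qed.

Lemma strip_reflect_hstrip s t u : hstrip s u && hstrip u t ->
  hstrip s (strip_reflect s t u) && hstrip (strip_reflect s t u) t.
Proof.
move=> stu; apply/hstrip2P => i il; rewrite row_strip_reflect //.
by move/hstrip2P: stu => /(_ i il); lia.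
Qed.

Lemma strip_reflectK s t u : hstrip s u && hstrip u t ->
  strip_reflect s t (strip_reflect s t u) = u.
Proof.
move=> stu; apply: row_inj => i; case: (ltnP i l.+1) => [il|li]; last by rewrite !row_out.
rewrite !row_strip_reflect ?strip_reflect_hstrip //.
by move/hstrip2P: stu => /(_ i il); lia.
Qed.

(** The lower bound in row [i] and the upper bound in row [i.+1] are the max and the min of the same
    two numbers, so they add up to [row s i + row t i.+1]. The two bounds left over are [row t 0]
    and [row s l]. *)
Lemma strip_min_max_sum s t :
  (\sum_(i < l.+1) (strip_min s t i + strip_max s t i) = boxes s + boxes t)%N.
Proof.
rewrite big_split /= big_ord_recr /= [X in (_ + X)%N]big_ord_recl /=.
have -> : strip_min s t l = row s l by rewrite /strip_min [row t _]row_out // maxn0.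
rewrite !boxesE big_ord_recr /= [X in (_ = _ + X)%N]big_ord_recl /=.
suff : (\sum_(i < l) strip_min s t i + \sum_(i < l) strip_max s t (bump 0 i) =
  \sum_(i < l) row s i + \sum_(i < l) row t (bump 0 i))%N by rewrite /bump /=; lia.
rewrite -!big_split; apply: eq_bigr => i _.
by rewrite /bump add1n /strip_min /=; lia.
Qed.

Lemma boxes_strip_reflect s t u : hstrip s u && hstrip u t ->
  (boxes (strip_reflect s t u) + boxes u = boxes s + boxes t)%N.
Proof.
move=> stu; rewrite -(strip_min_max_sum s t) !boxesE -big_split.
apply: eq_bigr => i _; rewrite /= row_strip_reflect //.
by move/hstrip2P: stu => /(_ i (ltn_ord i)); lia.
Qed.

Lemma hstrip_swap (R : pzSemiRingType) (y : R) m s t :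
  \sum_(u | [&& hstrip s u, hstrip u t & boxes u - boxes s == m]%N)
     y ^+ (boxes t - boxes u)
  = \sum_(u | [&& hstrip s u, hstrip u t & boxes t - boxes u == m]%N)
     y ^+ (boxes u - boxes s).
Proof.
rewrite (reindex_onto (strip_reflect s t) (strip_reflect s t)) /=; last first.
  by move=> u /and3P[su ut _]; rewrite strip_reflectK // su.
have key u : hstrip s u && hstrip u t ->
    (boxes t - boxes (strip_reflect s t u) = boxes u - boxes s)%N /\
    (boxes (strip_reflect s t u) - boxes s = boxes t - boxes u)%N.
  by move=> stu; have := boxes_strip_reflect stu; lia.
apply: eq_big => [u|u /andP[/and3P[su ut _] /eqP eu]].
  apply/idP/idP => [/andP[/and3P[su ut eb] /eqP eu]|/and3P[su ut eb]].
    have stu : hstrip s u && hstrip u t by rewrite -eu strip_reflect_hstrip // su ut.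
    by rewrite andbA stu -(key u stu).2.
  have stu : hstrip s u && hstrip u t by rewrite su.
  by rewrite andbA strip_reflect_hstrip // (key u stu).2 eb strip_reflectK /=.
have stu : hstrip s u && hstrip u t by rewrite -eu strip_reflect_hstrip // su ut.
by rewrite (key u stu).1.
Qed.

(** * Weighted chains of strips *)

Variables (R : comPzSemiRingType) (x : nat -> R).

Fixpoint chain_sum (N : nat) s t : R :=
  if N is N'.+1 then
    \sum_(u | hstrip u t) chain_sum N' s u * x N' ^+ (boxes t - boxes u)
  else (s == t)%:R.

(** By induction on [N], the strip of size [m] is moved past the weighted strips one at a time. *)
Lemma chain_sum_strip N m s t :
  \sum_(u | hstrip s u && (boxes u - boxes s == m)%N) chain_sum N u t
  = \sum_(u | hstrip u t && (boxes t - boxes u == m)%N) chain_sum N s u.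
Proof.
elim: N t => [|N IHN] t /=.
  rewrite big_mkcond [RHS]big_mkcond (bigD1 t) //= [RHS](bigD1 s) //= !eqxx.
  rewrite !big1 ?addr0 // => u /negbTE; first by rewrite eq_sym => ->; case: ifP.
  by move=> ->; case: ifP.
rewrite (exchange_big_dep (fun w => hstrip w t)) //=.
rewrite (eq_bigr (fun w => \sum_(u | hstrip u w && (boxes w - boxes u == m)%N)
    chain_sum N s u * x N ^+ (boxes t - boxes w))); last first.
  move=> w wt; rewrite -!mulr_suml; congr (_ * _); rewrite -IHN.
  by apply: eq_bigl => u; rewrite wt andbT.
(* With the start [u] of the last two strips fixed, both sides become sums over the single shape
   between [u] and [t], which [hstrip_swap] compares. *)
rewrite (exchange_big_dep predT) //= [RHS](exchange_big_dep predT) //=.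
apply: eq_bigr => u _; rewrite -!mulr_sumr; congr (_ * _).
have := hstrip_swap (x N) m u t.
under eq_bigl do rewrite andbCA.
by move=> ->; apply: eq_bigl => w; rewrite andbC.
Qed.

End HorizontalStrips.

(** * Tableaux as chains of horizontal strips *)

(** A down-closed set is an initial segment, hence determined by its cardinality. This lets [cut]
    define row lengths by counting. *)
Lemma mem_downset_card W (A : {set 'I_W}) (c : 'I_W) :
  (forall i j : 'I_W, (i < j)%N -> j \in A -> i \in A) -> (c \in A) = (c < #|A|)%N.
Proof.
move=> downA.
have cardlt (k : 'I_W) : #|[set i : 'I_W | (i < k)%N]| = k.
  rewrite -sum1_card (eq_bigl (fun i : 'I_W => (i < k)%N)) => [|i]; last by rewrite inE.
  by rewrite -(big_ord_widen _ (fun=> 1%N)) ?sum1_card ?card_ord // ltnW.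
apply/idP/idP => [cA|]; last first.
  apply: contraTT => cA; rewrite -leqNgt -[leqRHS](cardlt c); apply: subset_leq_card.
  apply/subsetP => i iA; rewrite inE ltnNge; apply: contra cA; rewrite leq_eqVlt.
  by case/orP=> [/eqP/val_inj ->//|/downA]; apply.
rewrite -[c.+1]add1n -(cardlt c).
have -> : (1 + #|[set i : 'I_W | (i < c)%N]| = #|c |: [set i : 'I_W | (i < c)%N]|)%N.
  by rewrite cardsU1 inE ltnn.
apply: subset_leq_card; apply/subsetP => i; rewrite !inE.
by case/orP=> [/eqP->//|/downA]; apply.
Qed.

Section BoxTableaux.
Variables l W B : nat.
Notation shape := {ffun 'I_l.+1 -> 'I_W.+1}.
Notation box := ('I_l.+1 * 'I_W)%type.
Notation filling := {ffun box -> 'I_B.+1}.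
Implicit Types (s t u : shape) (f g : filling) (p q : box).

(* A tableau of shape t / s with entries at most N, extended to the whole box
   by 0 on s and by B outside t; the letter x_k is encoded by the entry k.+1. *)
Definition boxtab (N : nat) s t f : bool :=
  [&& [forall p : box, (f p == 0%N :> nat) == (p.2 < s p.1)%N],
      [forall p : box, (f p <= N)%N == (p.2 < t p.1)%N],
      [forall p : box, (N < f p)%N ==> (f p == B :> nat)],
      [forall p : box, [forall q : box, ((p.1 == q.1) && (p.2 < q.2)%N) ==> (f p <= f q)%N]] &
      [forall p : box, [forall q : box,
        [&& p.2 == q.2, (p.1 < q.1)%N & (f q <= N)%N] ==> (f p <= (f q).-1)%N]]].

(** The truncated predecessor in the column condition covers two cases: below a positive entry it is
    strict increase, and above an entry 0 it forces another 0. *)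
Lemma boxtabP N s t f :
  reflect [/\ forall p : box, (f p == 0%N :> nat) = (p.2 < s p.1)%N,
              forall p : box, (f p <= N)%N = (p.2 < t p.1)%N,
              forall p : box, (N < f p)%N -> f p = B :> nat,
              forall (r : 'I_l.+1) (c d : 'I_W), (c < d)%N -> (f (r, c) <= f (r, d))%N &
              forall (q r : 'I_l.+1) (c : 'I_W), (q < r)%N -> (f (r, c) <= N)%N ->
                (f (q, c) <= (f (r, c)).-1)%N]
    (boxtab N s t f).
Proof.
apply: (iffP and5P) => [[/forallP H1 /forallP H2 /forallP H3 /forallP H4 /forallP H5]|].
  split=> [p|p|p|r c d cd|q r c qr frc].
  - exact: eqP (H1 p).
  - exact: eqP (H2 p).
  - by move/(implyP (H3 p))/eqP.
  - by have /forallP/(_ (r, d))/implyP := H4 (r, c); apply; rewrite eqxx.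
  - by have /forallP/(_ (r, c))/implyP := H5 (q, c); apply; rewrite eqxx qr.
case=> H1 H2 H3 H4 H5; split; apply/forallP => p; first exact/eqP.
- exact/eqP.
- by apply/implyP => /H3/eqP.
- apply/forallP => q; apply/implyP; case: p q => [r c] [r' d] /= /andP[/eqP <-].
  exact: H4.
- apply/forallP => q; apply/implyP; case: p q => [r c] [r' d] /= /and3P[/eqP <-].
  exact: H5.
Qed.

(** The shape filled by the entries at most [N], which is the penultimate shape of the chain when
    the entries go up to [N.+1]. *)
Definition cut (N : nat) f : shape :=
  [ffun r => inord #|[set c : 'I_W | (f (r, c) <= N)%N]|].

Lemma cutE N s t f M p : boxtab N s t f -> (p.2 < cut M f p.1)%N = (f p <= M)%N.
Proof.
case: p => r c /boxtabP[_ _ _ rowf _]; rewrite ffunE inordK /=; last first.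
  by rewrite ltnS; apply: leq_trans (max_card _) _; rewrite card_ord.
rewrite -mem_downset_card ?inE // => i j ij; rewrite !inE; apply: leq_trans.
exact: rowf.
Qed.

Lemma shape_eqP s t : (forall p : box, (p.2 < s p.1)%N = (p.2 < t p.1)%N) -> s = t.
Proof.
move=> st; apply/ffunP => r; apply/val_inj => /=.
wlog lt_st : s t st / (s r < t r)%N.
  by move=> wl; case: (ltngtP (s r) (t r)) => // lt; [|symmetry]; apply: wl.
have sW : (s r < W)%N by rewrite (leq_trans lt_st) // -ltnS.
by have := st (r, Ordinal sW); rewrite /= ltnn lt_st.
Qed.

(** Deletes the last letter: its boxes are handed over to the outside, marked by [B]. The operation
    [raise] below is its inverse. *)
Definition lower (N : nat) f : filling :=
  [ffun p => if f p == N.+1 :> nat then ord_max else f p].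

Definition raise (N : nat) t f : filling :=
  [ffun p => if (N < f p)%N && (p.2 < t p.1)%N then inord N.+1 else f p].

Lemma lowerE N f p : lower N f p = (if f p == N.+1 :> nat then B else f p) :> nat.
Proof. by rewrite ffunE; case: ifP. Qed.

Lemma raiseE N t f p : (N < B)%N ->
  raise N t f p = (if (N < f p)%N && (p.2 < t p.1)%N then N.+1 else f p) :> nat.
Proof. by move=> NB; rewrite ffunE; case: ifP => // _; rewrite inordK. Qed.

(** * Branching rule: removing the last letter *)

Section Branching.
Variables (N : nat) (NB : (N.+1 < B)%N).

Lemma cut_hstrip s t f : boxtab N.+1 s t f -> hstrip (cut N f) t.
Proof.
move=> tf; have cutf := cutE N _ tf; case/boxtabP: tf => f0 fN fB rowf colf.
apply/forallP => r; apply/andP; split.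
  (* Otherwise the first box of row [r] beyond the cut, whose entry exceeds [N], has a box of [t]
     below it, whose entry is at most [N.+1]; this contradicts strictness down the column. *)
  rewrite leqNgt; apply/negP => lt_r.
  have cW : (cut N f r < W)%N.
    exact: leq_trans lt_r (row_leW _ _).
  have := cutf (r, Ordinal cW); rewrite /= ltnn => /esym/negbT; rewrite -ltnNge.
  move: lt_r; rewrite /row; case: insubP => // r' _ r'E lt_r.
  have := fN (r', Ordinal cW); rewrite /= lt_r => fr'.
  have rr' : (r < r')%N by rewrite r'E.
  by have := colf _ _ _ rr' fr'; lia.
rewrite leqNgt; apply/negP => lt_r.
have cW : (t r < W)%N by rewrite (leq_trans lt_r) // -ltnS.
have := cutf (r, Ordinal cW); have := fN (r, Ordinal cW); rewrite /= ltnn lt_r.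
by lia.
Qed.

Lemma lowerK s t f : boxtab N.+1 s t f -> raise N t (lower N f) = f.
Proof.
case/boxtabP=> f0 fN fB _ _; apply/ffunP => p; apply/val_inj.
rewrite /= (raiseE _ _ _ (ltnW NB)) lowerE -(fN p); have := fB p.
by case: ifP; case: ifP; lia.
Qed.

Lemma lower_boxtab s t f : boxtab N.+1 s t f -> boxtab N s (cut N f) (lower N f).
Proof.
move=> tf; have cutf := cutE N _ tf; case/boxtabP: tf => f0 fN fB rowf colf.
apply/boxtabP; split=> [p|p|p|r c d cd|q r c qr]; rewrite ?cutf ?lowerE -?f0.
- by case: ifP; lia.
- by case: ifP; lia.
- by have := fB p; case: ifP; lia.
- have := rowf r c d cd; have := fB (r, d); have := ltn_ord (f (r, c)).
  by case: ifP; case: ifP; lia.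
- move=> frc; have := colf q r c qr; move: frc.
  by case: ifP; case: ifP; lia.
Qed.

Section Raise.
Variables (s t u : shape) (f : filling).
Hypotheses (ut : hstrip u t) (uf : boxtab N s u f).

Lemma raiseK : lower N (raise N t f) = f.
Proof.
case/boxtabP: uf => f0 fN fB _ _; apply/ffunP => p; apply/val_inj.
rewrite /= lowerE (raiseE _ _ _ (ltnW NB)); have := fB p.
by case: ifP; case: ifP; lia.
Qed.

Lemma raise_boxtab : boxtab N.+1 s t (raise N t f).
Proof.
case/boxtabP: uf => f0 fN fB rowf colf.
have le_ut (p : box) : (u p.1 <= t p.1)%N by move/forallP: ut => /(_ p.1)/andP[].
apply/boxtabP; split=> [p|p|p|r c d cd|q r c qr]; rewrite ?(raiseE _ _ _ (ltnW NB)) -?f0.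
- by case: ifP; lia.
- by have := fB p; have := fN p; have := le_ut p; case: ifP; lia.
- by have := fB p; have := fN p; have := le_ut p; case: ifP; lia.
- have := rowf r c d cd; have := fB (r, d); have := ltn_ord (f (r, c)).
  by rewrite /=; case: ifP; case: ifP; lia.
(* By interlacing, any box above a box of [t] lies in [u], so its entry is at most [N] and stays
   below a new entry [N.+1]. *)
have tu_qr : (t r <= u q)%N.
  move/hstripP: ut => tu; rewrite -row_ord -[u q : nat]row_ord.
  elim: (r : nat) qr => // r' IH; rewrite ltnS leq_eqVlt => /orP[/eqP ->|].
    by case/andP: (tu r').
  by move/IH; have := tu r'; lia.
have := colf q r c qr; have := fN (q, c); have := fN (r, c); have := fB (r, c) => /=.
by case: ifP; case: ifP; lia.
Qed.

Lemma cut_raise : cut N (raise N t f) = u.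
Proof.
have := cutE N _ raise_boxtab; case/boxtabP: uf => f0 fN fB rowf colf cutr.
apply: shape_eqP => p; rewrite cutr -fN (raiseE _ _ _ (ltnW NB)).
by case: ifP; lia.
Qed.

End Raise.
Section Weights.
Variables (R : comPzSemiRingType) (x : nat -> R).

Definition weight s t f : R := \prod_(p : box | (s p.1 <= p.2 < t p.1)%N) x (f p).-1.

Lemma prod_skew_const (y : R) s t : (forall r, s r <= t r)%N ->
  \prod_(p : box | (s p.1 <= p.2 < t p.1)%N) y = y ^+ (boxes t - boxes s).
Proof.
move=> le_st; rewrite -sumnB; last by move=> i _.
rewrite -(pair_big_dep predT (fun r (c : 'I_W) => s r <= c < t r)%N (fun _ _ => y)) /=.
rewrite -prodrXr; apply: eq_bigr => r _; rewrite prodr_const; congr (_ ^+ _).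
rewrite -sum1_card -(big_mkord (fun c => s r <= c < t r)%N (fun=> 1%N)).
rewrite -[RHS]muln1 -sum_nat_const_nat [RHS](big_nat_widen _ _ W) -1?ltnS //.
by rewrite [RHS](big_nat_widenl _ 0) //; apply: eq_bigl => c; lia.
Qed.

Lemma weight_raise s t u f : hstrip u t -> boxtab N s u f ->
  weight s t (raise N t f) = weight s u f * x N ^+ (boxes t - boxes u).
Proof.
move=> ut uf; have le_ut (r : 'I_l.+1) : (u r <= t r)%N by move/forallP: ut => /(_ r)/andP[].
case/boxtabP: uf => f0 fN fB rowf colf.
have le_su (p : box) : (p.2 < s p.1)%N -> (p.2 < u p.1)%N by rewrite -f0 -fN; lia.
rewrite /weight (bigID (fun p : box => (p.2 < u p.1)%N)) /=; congr (_ * _).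
  apply: eq_big => [p|p]; first by have := le_ut p.1; lia.
  by rewrite (raiseE _ _ _ (ltnW NB)) -fN => /andP[_]; case: ifP => //; lia.
rewrite -prod_skew_const //; apply: eq_big => [p|p].
  by have := le_su p; lia.
by rewrite (raiseE _ _ _ (ltnW NB)) -fN => /andP[/andP[_ ->]]; rewrite -ltnNge => ->.
Qed.

(** Tableaux are grouped by their shape [u] under [cut]; within a group, [lower] and [raise] are
    mutually inverse, and the deleted boxes contribute a power of [x N]. *)
Lemma boxtab_sum_branch s t :
  \sum_(f | boxtab N.+1 s t f) weight s t f =
  \sum_(u | hstrip u t)
    (\sum_(f | boxtab N s u f) weight s u f) * x N ^+ (boxes t - boxes u).
Proof.
rewrite (partition_big (cut N) (fun u => hstrip u t)) => [|f /cut_hstrip//].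
apply: eq_bigr => u ut; rewrite mulr_suml.
rewrite (reindex_onto (raise N t) (lower N)) => [|f /andP[tf _]]; last exact: lowerK tf.
apply: eq_big => [f|f].
  apply/idP/idP => [/andP[/andP[tf /eqP fu] /eqP ff]|uf].
    by rewrite -ff -fu; apply: lower_boxtab tf.
  by rewrite (raise_boxtab ut uf) (cut_raise ut uf) (raiseK ut uf) !eqxx.
case/andP=> /andP[tf /eqP fu] /eqP ff; apply: weight_raise => //.
by rewrite -ff -fu; apply: lower_boxtab tf.
Qed.

End Weights.
End Branching.

Lemma boxtab_sumE (R : comPzSemiRingType) (x : nat -> R) N s t : (N < B)%N ->
  (forall q r : 'I_l.+1, q < r -> s r <= s q)%N ->
  \sum_(f | boxtab N s t f) weight x s t f = chain_sum x N s t.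
Proof.
move=> + s_dec; elim: N t => [|N IHN] t NB; last first.
  rewrite boxtab_sum_branch //=; apply: eq_bigr => u _.
  by rewrite IHN // ltnW.
have [<-|st] /= := eqVneq s t; last first.
  rewrite (negbTE st) big_pred0 // => f; apply/negbTE/negP => /boxtabP[f0 fN _ _ _].
  by case/eqP: st; apply: shape_eqP => p; rewrite -f0 -fN leqn0.
(* The only tableau of the empty skew shape; the monotonicity of [s] gives its column condition. *)
pose f0 : filling := [ffun p : box => if (p.2 < s p.1)%N then ord0 else ord_max].
have f0E p : f0 p = (if (p.2 < s p.1)%N then 0 else B) :> nat.
  by rewrite ffunE; case: ifP.
rewrite eqxx (big_pred1 f0) => [|f]; last first.
  apply/boxtabP/eqP => [[fs _ fB _ _]|->].
    apply/ffunP => p; apply/val_inj; rewrite /= f0E -fs.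
    by case: ifP => [/eqP//|fp]; rewrite fB ?lt0n ?fp.
  split=> [p|p|p|r c d cd|q r c qr]; rewrite ?f0E /=.
  - by case: ifP => //; lia.
  - by case: ifP => //; lia.
  - by case: ifP => //; lia.
  - by case: ifP; case: ifP => //; lia.
  - by have := s_dec q r qr; case: ifP; case: ifP => //; lia.
by rewrite /weight big_pred0 // => p; lia.
Qed.
End BoxTableaux.

(** * Tableaux on skew diagrams as fillings of a box *)

Section Shapes.
Variables l W : nat.
Notation shape := {ffun 'I_l.+1 -> 'I_W.+1}.

Lemma geq_trans : transitive geq.
Proof. by move=> a b c ba cb; apply: leq_trans cb ba. Qed.

Lemma nth_sorted_geq (s : seq nat) i j :
  sorted geq s -> (i <= j)%N -> (nth 0%N s j <= nth 0%N s i)%N.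
Proof.
move=> ss ij; case: (ltnP j (size s)); last by move/(nth_default 0%N)->.
move=> js; have geq_refl : reflexive geq := leqnn.
by apply: (sorted_leq_nth geq_trans geq_refl 0%N ss) => //; rewrite inE ?(leq_ltn_trans ij js).
Qed.

Definition shape_of (s : seq nat) : shape := [ffun r : 'I_l.+1 => inord (nth 0%N s r)].

Lemma shape_ofE (s : seq nat) (r : 'I_l.+1) :
  sorted geq s -> (head 0 s <= W)%N -> shape_of s r = nth 0%N s r :> nat.
Proof.
move=> ss sW; rewrite ffunE inordK // ltnS; apply: leq_trans sW.
by rewrite -nth0 nth_sorted_geq.
Qed.

End Shapes.

(** The value 0 is a default: a chain of [N] steps evaluates this only at [i < N]. *)
Definition letter N (i : nat) : {mpoly int[N]} := if insub i is Some j then 'X_j else 0.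

Section Cells.
Variables rho kappa : seq nat.
Hypotheses (rho_dec : sorted geq rho) (kappa_dec : sorted geq kappa).

Definition cell_row (u : cell rho kappa) : nat := (val u).1.
Definition cell_col (u : cell rho kappa) : nat := (val u).2.

Lemma cell_inj u v : cell_row u = cell_row v -> cell_col u = cell_col v -> u = v.
Proof.
move=> ru cu; apply/val_inj; move: ru cu; rewrite /cell_row /cell_col.
by case: (val u) (val v) => a b [c d] /= /val_inj -> /val_inj ->.
Qed.

Lemma cell_skew u :
  (nth 0 kappa (cell_row u) <= cell_col u < nth 0 rho (cell_row u))%N.
Proof. exact: (valP u). Qed.

Lemma cell_ex i j : (nth 0 kappa i <= j < nth 0 rho i)%N ->
  exists2 u, cell_row u = i & cell_col u = j.
Proof.
move=> /andP[kj jr].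
have ir : (i < size rho)%N by rewrite ltnNge; apply: contraTN jr => /(nth_default 0%N) ->.
have jh : (j < head 0 rho)%N by rewrite (leq_trans jr) // -nth0 nth_sorted_geq.
have ij : @in_skew rho kappa (Ordinal ir, Ordinal jh) by rewrite /in_skew /= kj.
by exists (Sub _ ij).
Qed.

Lemma ssytP N (T : {ffun cell rho kappa -> 'I_N}) :
  reflect [/\ forall u v, cell_row u = cell_row v -> (cell_col u < cell_col v)%N ->
                (T u <= T v)%N &
              forall u v, cell_col u = cell_col v -> (cell_row u < cell_row v)%N ->
                (T u < T v)%N]
    (ssyt T).
Proof.
apply: (iffP forallP) => [H|[H1 H2] u].
  split=> u v uv uv'; have /forallP/(_ v)/andP[/implyP H1 /implyP H2] := H u.
    by apply: H1; rewrite uv' andbT; apply/eqP/val_inj.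
  by apply: H2; rewrite uv' andbT; apply/eqP/val_inj.
apply/forallP => v; apply/andP; split; apply/implyP => /andP[/eqP uv uv'].
  by apply: H1 => //; rewrite /cell_row uv.
by apply: H2 => //; rewrite /cell_col uv.
Qed.

Section ToBox.
Variables (l W N : nat).
Hypotheses (rho_l : (size rho <= l.+1)%N) (rho_W : (head 0 rho <= W)%N).
Hypothesis kappa_rho : forall i, (nth 0 kappa i <= nth 0 rho i)%N.
Notation shape := {ffun 'I_l.+1 -> 'I_W.+1}.
Notation box := ('I_l.+1 * 'I_W)%type.
Notation filling := {ffun box -> 'I_N.+2}.

Let kappa_W : (head 0 kappa <= W)%N.
Proof. by apply: leq_trans rho_W; rewrite -!nth0. Qed.

Let rowE (p : box) :
  (shape_of l W kappa p.1 <= p.2 < shape_of l W rho p.1)%N =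
  (nth 0 kappa p.1 <= p.2 < nth 0 rho p.1)%N.
Proof. by rewrite !shape_ofE. Qed.

Fact box_row_subproof (u : cell rho kappa) : (cell_row u < l.+1)%N.
Proof. exact: leq_trans (ltn_ord _) rho_l. Qed.

Fact box_col_subproof (u : cell rho kappa) : (cell_col u < W)%N.
Proof. exact: leq_trans (ltn_ord _) rho_W. Qed.

Definition box_of (u : cell rho kappa) : box :=
  (Ordinal (box_row_subproof u), Ordinal (box_col_subproof u)).

(** Here [B] is [N.+1], so [ord_max] marks the boxes outside [rho], and letters are shifted by one
    to leave 0 for the boxes of [kappa]. *)
Definition fill (T : {ffun cell rho kappa -> 'I_N}) : filling :=
  [ffun p : box => if [pick u | box_of u == p] is Some u then inord (T u).+1
           else if (p.2 < nth 0 kappa p.1)%N then ord0 else ord_max].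

Lemma box_of_inj : injective box_of.
Proof. by move=> u v [ru cu]; apply: cell_inj. Qed.

Lemma fill_box_of T u : fill T (box_of u) = (T u).+1 :> nat.
Proof.
rewrite ffunE; case: pickP => [v /eqP/box_of_inj ->|/(_ u)]; last by rewrite eqxx.
by rewrite inordK // ltnS ltnW // ltnS.
Qed.

Variant box_spec (p : box) : bool -> bool -> Prop :=
| BoxInner of (p.2 < nth 0 kappa p.1)%N : box_spec p true true
| BoxCell u of p = box_of u & p.1 = cell_row u :> nat & p.2 = cell_col u :> nat :
    box_spec p false true
| BoxOuter of (nth 0 rho p.1 <= p.2)%N : box_spec p false false.

Lemma boxP (p : box) : box_spec p (p.2 < nth 0 kappa p.1)%N (p.2 < nth 0 rho p.1)%N.
Proof.
case: ltnP => pk; first by rewrite (leq_trans pk (kappa_rho _)); constructor.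
case: ltnP => pr; last by constructor.
have [u ru cu] := cell_ex (introT andP (conj pk pr)).
apply: (@BoxCell p u) => //; case: p ru cu {pk pr} => a b /= ru cu.
by rewrite /box_of; congr (_, _); apply: val_inj.
Qed.

Lemma fillE T (p : box) :
  fill T p = (if (p.2 < nth 0 kappa p.1)%N then 0%N else
              if (p.2 < nth 0 rho p.1)%N then fill T p : nat else N.+1) :> nat.
Proof.
have [pk|u _ _ _|pr] := boxP p => //; rewrite ffunE; case: pickP => [u /eqP up|_].
- by have := cell_skew u; rewrite -up in pk; move: pk; rewrite /=; lia.
- by rewrite pk.
- by have := cell_skew u; rewrite -up in pr; move: pr; rewrite /=; lia.
- by case: ifP => //; have := kappa_rho p.1; lia.
Qed.

Lemma fill_boxtab T : ssyt T ->
  boxtab N (shape_of l W kappa) (shape_of l W rho) (fill T).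
Proof.
move=> /ssytP[rowT colT]; apply/boxtabP; split=> [p|p|p|r c d cd|q r c qr].
- rewrite shape_ofE // fillE; have [//|u -> _ _|//] := boxP p.
  by rewrite fill_box_of.
- rewrite shape_ofE // fillE; have [//|u -> _ _|//] := boxP p; last by rewrite ltnn.
  by rewrite fill_box_of ltn_ord.
- rewrite fillE; have [//|u -> _ _|//] := boxP p.
  by rewrite fill_box_of ltnS leqNgt ltn_ord.
- rewrite (fillE T (r, c)) (fillE T (r, d)); have [//|u eu ru cu|pr] := boxP (r, c).
    have [pk|v ev rv cv|_] := boxP (r, d).
    + by have := cell_skew u; move: ru cu pk => /= <- <-; lia.
    + by rewrite eu ev !fill_box_of ltnS; apply: rowT; rewrite -?ru -?cu -?cv.
    + by rewrite -ltnS.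
  have [pk|v ev rv cv|//] := boxP (r, d); first by have := kappa_rho r; move: pr pk => /=; lia.
  by have := cell_skew v; move: pr rv cv => /= pr <- <-; lia.
rewrite (fillE T (r, c)) (fillE T (q, c)); have [pk _|u eu ru cu|pr] := boxP (r, c).
- by rewrite (leq_trans pk) // nth_sorted_geq // ltnW.
- rewrite eu fill_box_of => _; have [//|v ev rv cv|pr] := boxP (q, c).
    by rewrite ev fill_box_of; apply: colT; rewrite -?ru -?rv -?cu -?cv.
  have := cell_skew u; rewrite -ru -cu; move: pr.
  by have := nth_sorted_geq rho_dec (ltnW qr); rewrite /=; lia.
- by rewrite ltnn.
Qed.

Lemma fill_inj : injective fill.
Proof.
move=> T T' TT; apply/ffunP => u; apply/val_inj/eqP; rewrite -eqSS /=.
by rewrite -!fill_box_of TT.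
Qed.

Lemma fill_surj f : boxtab N (shape_of l W kappa) (shape_of l W rho) f ->
  exists2 T, ssyt T & f = fill T.
Proof.
case/boxtabP => f0 fN fB rowf colf.
have fpos u : (0 < f (box_of u))%N.
  by rewrite lt0n f0 shape_ofE // -leqNgt; case/andP: (cell_skew u).
have fu u : ((f (box_of u)).-1 < N)%N.
  rewrite prednK // fN shape_ofE //; by case/andP: (cell_skew u).
pose T := [ffun u => Ordinal (fu u)].
have TE u : T u = (f (box_of u)).-1 :> nat by rewrite ffunE.
exists T; last first.
  apply/ffunP => p; apply/val_inj; rewrite /= fillE.
  have := f0 p; have := fN p; have := fB p; rewrite !shape_ofE //.
  have [_|u eu _ _|_] := boxP p; first by lia.
    by rewrite eu fill_box_of TE prednK.
  by lia.
have rowf2 (p q : box) : p.1 = q.1 -> (p.2 < q.2)%N -> (f p <= f q)%N.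
  by case: p q => [r c] [r' d] /= ->; apply: rowf.
have colf2 (p q : box) : p.2 = q.2 -> (p.1 < q.1)%N -> (f q <= N)%N -> (f p <= (f q).-1)%N.
  by case: p q => [r c] [r' d] /= ->; apply: colf.
apply/ssytP; split=> u v uv uv'; rewrite !TE; have := fpos u; have := fpos v.
  have : (f (box_of u) <= f (box_of v))%N by apply: rowf2 => //; apply: val_inj.
  by lia.
have : (f (box_of u) <= (f (box_of v)).-1)%N.
  by apply: colf2 => //; [apply: val_inj|have := fu v; lia].
by lia.
Qed.

Lemma weight_fill T :
  weight (letter N) (shape_of l W kappa) (shape_of l W rho) (fill T) =
  \prod_(u : cell rho kappa) 'X_(T u).
Proof.
rewrite /weight (eq_bigl (mem (box_of @: [set: cell rho kappa]))) => [|p]; last first.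
  rewrite rowE; apply/idP/imsetP => [|[u _ ->]]; last exact: cell_skew.
  by have [pk|u -> _ _ _|pr] := boxP p; [lia|exists u|lia].
rewrite big_imset => [|u v _ _ /box_of_inj//]; apply: eq_big => [u|u _]; first by rewrite inE.
by rewrite fill_box_of /letter valK.
Qed.

(** The map [fill] is a weight-preserving bijection onto the box tableaux, whose generating function
    is already a chain sum. *)
Lemma skew_schur_chain_sum :
  skew_schur N rho kappa =
  chain_sum (letter N) N (shape_of l W kappa) (shape_of l W rho).
Proof.
rewrite -(@boxtab_sumE _ _ N.+1) // => [|q r qr]; last first.
  by rewrite !shape_ofE // nth_sorted_geq // ltnW.
rewrite (eq_bigl (mem (fill @: [set T | ssyt T]))) => [|f]; last first.
  apply/idP/imsetP => [/fill_surj[T sT ->]|[T]]; first by exists T; rewrite ?inE.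
  by rewrite inE => /fill_boxtab ? ->.
rewrite big_imset => [|u v _ _ /fill_inj//]; apply: eq_big => [T|T _]; first by rewrite inE.
by rewrite weight_fill.
Qed.

End ToBox.
End Cells.

(** * The skew Pieri rule *)

(** In a decreasing list the zeros form a tail, and reading past the end also returns 0. *)
Lemma nth_filter_pos (s : seq nat) i :
  sorted geq s -> nth 0%N [seq x <- s | (0 < x)%N] i = nth 0%N s i.
Proof.
elim: s i => // x s IH i xs; have ss := path_sorted xs.
case: x xs => [|x] xs /=; last by case: i => //= i; apply: IH.
rewrite IH //; have := nth_sorted_geq xs (leq0n i.+1) => /=.
have := nth_sorted_geq xs (leq0n i) => /=.
by case: i => [|i] /=; lia.
Qed.

Lemma eq_nth_partition (s t : seq nat) :
  is_partition s -> is_partition t -> (forall i, nth 0%N s i = nth 0%N t i) -> s = t.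
Proof.
move=> /andP[_ s0] /andP[_ t0] st; apply: (@eq_from_nth _ 0%N) => //.
wlog lt_st : s t s0 t0 st / (size s < size t)%N.
  move=> wl; have [lt|lt|//] := ltngtP (size s) (size t); last symmetry; exact: wl.
by case/negP: t0; rewrite -(nth_default 0%N (leqnn (size s))) st mem_nth.
Qed.

Section Pieri.
Variables l W : nat.
Notation shape := {ffun 'I_l.+1 -> 'I_W.+1}.
Implicit Types v : shape.

Definition parts_of v : seq nat := [seq x <- [seq val (v r) | r <- enum 'I_l.+1] | (0 < x)%N].

Lemma nth_codom v i : nth 0%N [seq val (v r) | r <- enum 'I_l.+1] i = row v i.
Proof.
case: (ltnP i l.+1) => il; last first.
  by rewrite row_out // nth_default // size_map size_enum_ord.
by rewrite (nth_map ord0) ?size_enum_ord // -[i]/(val (Ordinal il)) nth_ord_enum row_ord.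
Qed.

Section Decreasing.
Variable v : shape.
Hypothesis v_dec : forall i, (row v i.+1 <= row v i)%N.

Lemma codom_sorted : sorted geq [seq val (v r) | r <- enum 'I_l.+1].
Proof. by apply/(sortedP 0%N) => i _; rewrite !nth_codom; apply: v_dec. Qed.

Lemma nth_parts_of i : nth 0%N (parts_of v) i = row v i.
Proof. by rewrite nth_filter_pos ?nth_codom // codom_sorted. Qed.

Lemma parts_of_partition : is_partition (parts_of v).
Proof.
by rewrite /is_partition mem_filter ltnn andbT (sorted_filter geq_trans) ?codom_sorted.
Qed.

Lemma parts_of_head : (head 0 (parts_of v) <= W)%N.
Proof. by rewrite -nth0 nth_parts_of row_leW. Qed.

Lemma shape_of_parts_of : shape_of l W (parts_of v) = v.
Proof.
apply/ffunP => r; apply/val_inj; rewrite /= shape_ofE ?parts_of_head //.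
  by rewrite nth_parts_of row_ord.
by case/andP: parts_of_partition.
Qed.

Lemma schur_chain_sum N :
  schur N (parts_of v) = chain_sum (letter N) N (shape_of l W [::]) v.
Proof.
have /andP[sv _] := parts_of_partition.
rewrite /schur (@skew_schur_chain_sum _ _ _ _ l W) ?shape_of_parts_of ?parts_of_head //.
  by rewrite size_filter (leq_trans (count_size _ _)) // size_map size_enum_ord.
by move=> i; rewrite nth_nil.
Qed.

End Decreasing.

Lemma hstrip_dec (s t : shape) : hstrip s t -> forall i, (row s i.+1 <= row s i)%N.
Proof. by move/hstripP=> st i; have := st i; have := st i.+1; lia. Qed.

End Pieri.

Lemma skew_schur_pieri N (rho : seq nat) m :
    sorted geq rho -> (m <= head 0 rho)%N ->
  let t := shape_of (size rho).-1 (head 0 rho) rho in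
  skew_schur N rho [:: m] =
  \sum_(v | hstrip v t && (boxes t - boxes v == m)%N) schur N (parts_of v).
Proof.
set l := (size rho).-1; set W := head 0 rho => rho_dec mW t.
have rho_m i : (nth 0 [:: m] i <= nth 0 rho i)%N.
  by case: i => [|i]; rewrite /= ?nth_nil // nth0.
have m0 : shape_of l W [:: m] ord0 = m :> nat by rewrite shape_ofE.
have mS i : (0 < i)%N -> row (shape_of l W [:: m]) i = 0%N.
  move=> i0; case: (ltnP i l.+1) => il; last by rewrite row_out.
  rewrite -[i]/(val (Ordinal il)) row_ord shape_ofE //=.
  by case: i i0 {il} => //= i _; rewrite nth_nil.
have z i : row (shape_of l W [::]) i = 0%N.
  case: (ltnP i l.+1) => il; last by rewrite row_out.
  by rewrite -[i]/(val (Ordinal il)) row_ord shape_ofE //= nth_nil.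
have boxz : boxes (shape_of l W [::]) = 0%N by rewrite boxesE big1.
have boxm u : (forall i, 0 < i -> row u i = 0)%N -> @boxes l W u = row u 0.
  move=> u0; rewrite boxesE big_ord_recl /= big1 ?addn0 // => i _.
  by rewrite u0.
(* The row of length [m] is the only shape that is a horizontal strip of size [m] over the empty
   shape. Hence one side of [chain_sum_strip], started at the empty shape, has a single term. *)
rewrite (@skew_schur_chain_sum _ _ _ _ l W) // ?leqSpred //.
under eq_bigr => v /andP[/hstrip_dec vt _] do rewrite schur_chain_sum //.
rewrite -chain_sum_strip (big_pred1 (shape_of l W [:: m])) // => u.
rewrite boxz subn0; apply/andP/eqP => [[/hstripP zu /eqP bu]|->].
  have u0 i : (0 < i)%N -> row u i = 0%N by case: i => // i _; have := zu i; rewrite z; lia.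
  apply: row_inj => -[|i]; last by rewrite mS // u0.
  by rewrite -boxm // bu -[0%N]/(val (@ord0 l)) row_ord.
split; last by rewrite boxm // -[X in row _ X]/(val (@ord0 l)) row_ord m0.
by apply/hstripP => i; rewrite z mS.
Qed.

(** * Linear independence of Schur functions *)

Section Content.
Variables (mu : seq nat).
Hypothesis mu_dec : sorted geq mu.
Notation mcell := (cell mu [::]).

Definition content N (T : {ffun mcell -> 'I_N}) : 'X_{1.. N} := (\sum_(u : mcell) U_(T u))%MM.

(** The statistic n(mu), the sum of i mu_i with rows counted from 0; it supplies the order for the
    triangularity argument. *)
Definition row_sum : nat := (\sum_(u : mcell) cell_row u)%N.

Lemma mcoeff_schur N (m : 'X_{1.. N}) :
  (schur N mu)@_m = \sum_(T : {ffun mcell -> 'I_N} | ssyt T) (content T == m)%:R.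
Proof.
rewrite /schur /skew_schur raddf_sum; apply: eq_bigr => T _ /=.
by rewrite mprodXE mcoeffX.
Qed.

Lemma contentE N (T : {ffun mcell -> 'I_N}) i :
  content T i = #|[set u | T u == i]|.
Proof.
rewrite /content mnm_sumE -sum1_card big_mkcond [RHS]big_mkcond.
by apply: eq_bigr => u _; rewrite mnm1E inE; case: eqP.
Qed.

Lemma content_row_sum N (T : {ffun mcell -> 'I_N}) :
  (\sum_(i < N) i * content T i = \sum_u T u)%N.
Proof.
rewrite (eq_bigr (fun i : 'I_N => \sum_u i * (T u == i)))%N; last first.
  by move=> i _; rewrite /content mnm_sumE big_distrr; apply: eq_bigr => u _; rewrite mnm1E.
rewrite exchange_big; apply: eq_bigr => u _ /=.
rewrite (bigD1 (T u)) //= eqxx muln1 big1 ?addn0 // => i iT.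
by rewrite eq_sym (negbTE iT) muln0.
Qed.

(** Strict increase down a column that starts in row 0. *)
Lemma ssyt_ge_row N (T : {ffun mcell -> 'I_N}) u : ssyt T -> (cell_row u <= T u)%N.
Proof.
case/ssytP=> _ colT; move: {2}(cell_row u) (erefl (cell_row u)) => k.
elim: k u => [|k IH] u uk; first by rewrite uk.
have [v vk vu] : exists2 v : mcell, cell_row v = k & cell_col v = cell_col u.
  apply: cell_ex => //; have := cell_skew u; rewrite !nth_nil /= uk => /leq_trans; apply.
  exact: nth_sorted_geq.
by rewrite uk -vk; apply: leq_ltn_trans (IH v vk) _; apply: colT; rewrite ?vk ?uk.
Qed.

Lemma card_row i : #|[set u : mcell | cell_row u == i]| = nth 0%N mu i.
Proof.
rewrite cardE -(size_map (@cell_col _ _)) -[RHS](size_iota 0); apply: perm_size.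
apply: uniq_perm; rewrite ?iota_uniq //.
  rewrite map_inj_in_uniq ?enum_uniq // => u v; rewrite !mem_enum !inE.
  by move=> /eqP ui /eqP vi; apply: cell_inj; rewrite ui.
move=> j; rewrite mem_iota add0n /=; apply/mapP/idP => [[u]|ji].
  by rewrite mem_enum inE => /eqP <- ->; case/andP: (cell_skew u).
have [u ui uj] : exists2 u : mcell, cell_row u = i & cell_col u = j.
  by apply: cell_ex => //; rewrite nth_nil.
by exists u; rewrite ?mem_enum ?inE ?ui ?uj.
Qed.

End Content.

(** The superstandard tableau, whose content is [nu] itself. *)
Definition row_filling (nu : seq nat) : {ffun cell nu [::] -> 'I_(size nu)} :=
  [ffun u => (val u).1].

Lemma row_filling_ssyt nu : ssyt (row_filling nu).
Proof.
apply/ssytP; split=> u v; rewrite !ffunE -/(cell_row u) -/(cell_row v) => //.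
by move=> ->.
Qed.

(** The content fixes the sum of the entries of [T] as [row_sum nu], while each entry is at least
    its row index. Equality of the sums makes each entry equal to its row index, so the row lengths
    of [mu] are read off the content. *)
Lemma ssyt_content_row_filling (mu nu : intpart) (T : {ffun cell mu [::] -> 'I_(size nu)}) :
    ssyt T -> content T = content (row_filling nu) ->
  (row_sum mu <= row_sum nu)%N /\ (row_sum mu = row_sum nu -> mu = nu).
Proof.
move=> sT cT; have mu_part := valP mu; have nu_part := valP nu.
have mu_dec : sorted geq mu by case/andP: mu_part.
have nu_dec : sorted geq nu by case/andP: nu_part.
have sumT : (\sum_u T u = row_sum nu)%N.
  by rewrite -content_row_sum cT content_row_sum; apply: eq_bigr => u _; rewrite ffunE.
have geT u : (cell_row u <= T u)%N by apply: ssyt_ge_row.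
rewrite -sumT; split=> [|eqT]; first by apply: leq_sum.
have rowT u : cell_row u = T u.
  have := leqif_sum (fun u _ => leqif_eq (geT u)) => /(_ xpredT) [_].
  by rewrite -/(row_sum mu) eqT eqxx => /esym/forallP/(_ u)/eqP.
apply/val_inj/eq_nth_partition => // i.
case: (ltnP i (size nu)) => iN.
  move/(congr1 (fun m : 'X_{1.. size nu} => m (Ordinal iN))): cT.
  rewrite !contentE -!card_row // => cT.
  rewrite (_ : [set u | cell_row u == i] = [set u | T u == Ordinal iN]) ?cT; last first.
    by apply/setP => u; rewrite !inE rowT.
  by apply: eq_card => u; rewrite !inE ffunE.
(* A box of [mu] in a row [i >= size nu] would carry the entry [i], which is not an available
   letter. *)
rewrite [RHS]nth_default //; apply/eqP; rewrite -leqn0 leqNgt; apply/negP => mui.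
have [u ui _] : exists2 u : cell mu [::], cell_row u = i & cell_col u = 0%N.
  by apply: cell_ex => //; rewrite nth_nil.
by have := ltn_ord (T u); rewrite -rowT ui ltnNge iN.
Qed.

(** Strong induction on [row_sum nu], comparing coefficients at the content of [row_filling nu]: a
    different [mu] with smaller [row_sum] has coefficient 0 by induction, and any other [mu] has no
    tableau of that content. *)
Lemma schur_lin_indep (F : seq intpart) (c : intpart -> int) :
    uniq F -> (forall N, \sum_(nu <- F) c nu *: schur N nu = 0) ->
  forall nu, nu \in F -> c nu = 0.
Proof.
move=> uF sum0 nu; move: {2}(row_sum nu) (erefl (row_sum nu)) => k.
elim/ltn_ind: k nu => k IH nu nuk nuF.
have := congr1 (mcoeff (content (row_filling nu))) (sum0 (size nu)).
rewrite raddf_sum mcoeff0 (bigD1_seq nu) //= big_seq_cond big1 ?addr0 => [|mu /andP[muF mu_nu]].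
  rewrite mcoeffZ mcoeff_schur => /eqP; rewrite mulf_eq0 => /orP[/eqP//|].
  (* The coefficient in [schur nu] counts tableaux, one of which is [row_filling nu], so it is
     nonzero. *)
  rewrite (bigD1 (row_filling nu)) ?row_filling_ssyt //= eqxx -natr_sum -natrD.
  by rewrite Num.Theory.pnatr_eq0.
rewrite mcoeffZ mcoeff_schur.
have [lt_mu|le_mu] := ltnP (row_sum mu) k; first by rewrite (IH _ lt_mu mu) ?mul0r.
rewrite big1 ?mulr0 // => T sT; case: eqP => // cT.
have [leq_s eq_s] := ssyt_content_row_filling sT cT.
case/eqP: mu_nu; apply: eq_s; apply/eqP; rewrite eqn_leq leq_s /=; lia.
Qed.

Lemma schur_expansion_unique (rho kappa : seq nat) (c c' : {fsfun intpart -> int with 0}) :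
  schur_expansion rho kappa c -> schur_expansion rho kappa c' -> c =1 c'.
Proof.
move=> ec ec'; pose G := (finsupp c `|` finsupp c')%fset.
have sumG (d : {fsfun intpart -> int with 0}) N : (finsupp d `<=` G)%fset ->
    \sum_(nu <- finsupp d) d nu *: schur N nu = \sum_(nu <- G) d nu *: schur N nu.
  move=> dG; apply: big_fset_incl => // nu _ nud.
  by rewrite fsfun_dflt ?scale0r.
have cc' nu : nu \in G -> c nu - c' nu = 0.
  apply: (schur_lin_indep (c := fun nu => c nu - c' nu) (fset_uniq G)) => N.
  under eq_bigr do rewrite scalerBl.
  by rewrite big_split sumrN /= -!sumG ?fsubsetUl ?fsubsetUr // -ec -ec' subrr.
move=> nu; apply/eqP; rewrite -subr_eq0; apply/eqP.
have [/cc'//|] := boolP (nu \in G); rewrite in_fsetU negb_or => /andP[nc nc'].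
by rewrite !fsfun_dflt // subrr.
Qed.

(** * Schur expansion after removal of a one-row shape *)

Definition intpart0 : intpart := @IntPart [::] isT.

(** The default [intpart0] is never returned: interlacing makes each [v] decreasing, so [parts_of v]
    is a partition. *)
Definition pieri_parts (rho : seq nat) (m : nat) : seq intpart :=
  let t := shape_of (size rho).-1 (head 0%N rho) rho in
  [seq insubd intpart0 (parts_of v) |
     v <- enum [pred v | hstrip v t && (boxes t - boxes v == m)%N]].

Lemma pieri_partsP (rho : seq nat) m (nu : intpart) :
  let t := shape_of (size rho).-1 (head 0%N rho) rho in
  reflect (exists2 v, hstrip v t && (boxes t - boxes v == m)%N & nu = parts_of v :> seq nat)
    (nu \in pieri_parts rho m).
Proof.
set t := shape_of _ _ _ => /=; apply: (iffP mapP) => -[v].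
  rewrite mem_enum inE => /andP[vt bv] ->; exists v; first by rewrite vt.
  by rewrite insubdK //; apply: parts_of_partition; apply: hstrip_dec vt.
move=> /andP[vt bv] nuv; exists v; first by rewrite mem_enum inE vt.
by apply: val_inj; rewrite insubdK //; apply: parts_of_partition; apply: hstrip_dec vt.
Qed.

Lemma pieri_expansion (rho : seq nat) m :
    sorted geq rho -> (m <= head 0 rho)%N ->
  exists2 c : {fsfun intpart -> int with 0},
    schur_expansion rho [:: m] c & forall nu, c nu = (nu \in pieri_parts rho m)%:R.
Proof.
move=> rho_dec mW; set F := pieri_parts rho m.
pose c : {fsfun intpart -> int with 0} := [fsfun nu in [fset nu | nu in F]%fset => 1].
have cE nu : c nu = (nu \in F)%:R by rewrite fsfunE in_fset /=; case: ifP.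
exists c => // N.
have uF : uniq F.
  rewrite map_inj_in_uniq ?enum_uniq // => u v; rewrite !mem_enum !inE => /andP[ut _] /andP[vt _].
  move=> /(congr1 val); rewrite /= !insubdK;
    try by apply: parts_of_partition; apply: hstrip_dec; eassumption.
  (* The shape is recovered from its parts, so distinct strips give distinct partitions and the
     expansion is multiplicity free. *)
  move/(congr1 (shape_of (size rho).-1 (head 0%N rho))).
  by rewrite !shape_of_parts_of //; apply: hstrip_dec; eassumption.
rewrite (perm_big F) /=; last first.
  apply: uniq_perm => [||nu] //; rewrite ?fset_uniq // mem_finsupp cE.
  by case: (nu \in F).
rewrite skew_schur_pieri // big_seq.
under eq_bigr => nu nuF do rewrite cE nuF scale1r.
rewrite -big_seq big_map big_enum_cond /=.
apply: eq_big => [v|v /andP[/hstrip_dec vt _]]; first by rewrite inE andbT.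
by rewrite -[parts _]/(val _) insubdK //; apply: parts_of_partition.
Qed.

Lemma nat_nthP (s : seq nat) (x : nat) :
  x \in s -> exists2 i : nat, (i < size s)%N & nth 0%N s i = x.
Proof. by move/(nthP 0%N). Qed.

(** * Fat staircases *)

(** Since [nth] returns 0 past the end, this also bounds the last part by 1. *)
Definition gentle (s : seq nat) : Prop := forall i, (nth 0 s i <= (nth 0 s i.+1).+1)%N.

(** The parts of [delta a] of size at most [k], isolated to allow induction on [k]. *)
Definition delta_upto (a : seq nat) (k : nat) : seq nat :=
  flatten [seq nseq (nth 0%N a i.-1) i | i <- rev (iota 1 k)].

Lemma delta_uptoS a k :
  delta_upto a k.+1 = nseq (nth 0%N a k) k.+1 ++ delta_upto a k.
Proof. by rewrite /delta_upto -[X in rev (iota 1 X)]addn1 iotaD rev_cat. Qed.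

Lemma mem_delta_upto_le a k (i : nat) : i \in delta_upto a k -> (0 < i <= k)%N.
Proof.
elim: k => // k IH; rewrite delta_uptoS mem_cat mem_nseq => /orP[/andP[_ /eqP ->]|/IH].
  by rewrite leqnn.
by lia.
Qed.

Lemma delta_partition a : is_partition (delta a).
Proof.
rewrite -[delta a]/(delta_upto a (size a)); apply/andP; split; last first.
  by apply/negP => /mem_delta_upto_le.
elim: (size a) => // k IH; rewrite delta_uptoS.
rewrite (sorted_pairwise geq_trans) pairwise_cat -!(sorted_pairwise geq_trans) IH andbT.
apply/andP; split.
  by apply/allrelP => x y; rewrite mem_nseq => /andP[_ /eqP ->] /mem_delta_upto_le; rewrite /=; lia.
by case: nth => //= n; elim: n => //= n ->; rewrite leqnn.
Qed.

Lemma count_delta a i : (0 < i)%N -> count_mem i (delta a) = nth 0%N a i.-1.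
Proof.
move=> i0; rewrite -[delta a]/(delta_upto a (size a)).
have H k : count_mem i (delta_upto a k) = if (i <= k)%N then nth 0%N a i.-1 else 0%N.
  elim: k => [|k IH]; first by case: ifP => //; lia.
  rewrite delta_uptoS count_cat count_nseq IH /= -[(i <= k)%N]ltnS.
  by case: ltngtP => [_|_|->] //=; rewrite mul1n addn0.
rewrite H; case: leqP => // ai; rewrite nth_default //; lia.
Qed.

Lemma mem_delta a (i : nat) : is_composition a -> (i \in delta a) = (0 < i <= size a)%N.
Proof.
move=> ca; apply/idP/idP => [/mem_delta_upto_le//|/andP[i0 ia]].
rewrite -has_pred1 has_count count_delta // lt0n; apply: contra ca => /eqP <-.
by rewrite mem_nth // prednK.
Qed.

(** If a part x is at least 2, then x - 1 is also a part and stands further right, so the part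
    following x is at least x - 1. *)
Lemma delta_gentle a : is_composition a -> gentle (delta a).
Proof.
move=> ca r; have /andP[sa _] := delta_partition a.
case: (ltnP (nth 0%N (delta a) r) 2) => [|x2]; first by lia.
have r_size : (r < size (delta a))%N.
  by rewrite ltnNge; apply: contraTN x2 => /(nth_default 0%N) ->.
have x_le : (0 < nth 0%N (delta a) r <= size a)%N by rewrite -mem_delta // mem_nth.
have /nat_nthP[i i_size iE] : (nth 0%N (delta a) r).-1 \in delta a by rewrite mem_delta //; lia.
have ri : (r.+1 <= i)%N.
  by rewrite ltnNge; apply/negP => /(nth_sorted_geq sa); lia.
by have := nth_sorted_geq sa ri; lia.
Qed.

Lemma head_delta a : is_composition a -> head 0%N (delta a) = size a.
Proof.
move=> ca; have /andP[sa _] := delta_partition a.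
case: (posnP (size a)) => [/size0nil -> //|a0].
have /nat_nthP[i _ iE] : size a \in delta a by rewrite mem_delta // a0 leqnn.
have := nth_sorted_geq sa (leq0n i); rewrite iE nth0 => le_a.
have : head 0%N (delta a) \in delta a.
  by rewrite -nth0 mem_nth //; move: le_a; case: (delta a) => //=; lia.
by rewrite mem_delta //; lia.
Qed.

(** Descending to 0 in steps of at most 1 skips no value. *)
Lemma gentle_mem (s : seq nat) (i : nat) : gentle s -> (0 < i <= head 0%N s)%N -> i \in s.
Proof.
elim: s => [|x s IH] gs /=; first by lia.
move=> /andP[i0 ix]; rewrite in_cons; case: eqP => //= /eqP neq_ix; apply: IH.
  by move=> k; apply: (gs k.+1).
by have := gs 0%N; rewrite /= nth0; lia.
Qed.

Lemma gentle_fat (nu : seq nat) : is_partition nu -> gentle nu -> fat_staircase nu.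
Proof.
move=> nup gnu; have /andP[snu nu0] := nup.
(* The composition is the list of multiplicities, positive because every value up to the largest
   part occurs. Decreasing lists with equal multiplicities coincide. *)
exists (mkseq (fun i => count_mem i.+1 nu) (head 0%N nu)).
  apply/negP => /nat_nthP[i]; rewrite size_mkseq => ih; rewrite nth_mkseq // => /eqP.
  by rewrite -leqn0 leqNgt -has_count has_pred1 gentle_mem.
set b := mkseq _ _; have /andP[sb b0] := delta_partition b.
have geq_anti : antisymmetric geq by move=> x y /= ?; apply/eqP; lia.
apply: (sorted_eq geq_trans geq_anti) => //; apply/allP => i _ /=; apply/eqP.
case: i => [|i]; first by rewrite !(count_memPn _).
rewrite count_delta //= ; case: (ltnP i (head 0%N nu)) => ih; first by rewrite nth_mkseq.
rewrite [RHS]nth_default ?size_mkseq //; apply/count_memPn; apply/negP => /nat_nthP[k _ kE].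
by have := nth_sorted_geq snu (leq0n k); rewrite nth0 kE; lia.
Qed.

Lemma count_mem_split (s : seq nat) i : (i < size s)%N -> let j := nth 0%N s i in
  count_mem j s = (count_mem j (take i s) + (count_mem j (drop i.+1 s)).+1)%N.
Proof.
move=> i_size j; rewrite -{1}(cat_take_drop i s) count_cat (drop_nth 0%N) //= eqxx.
by rewrite add1n.
Qed.

Lemma isolated_count1 (s : seq nat) i : sorted geq s ->
    (nth 0%N s i.+2 < nth 0%N s i.+1)%N -> (nth 0%N s i.+1 < nth 0%N s i)%N ->
  count_mem (nth 0%N s i.+1) s = 1%N.
Proof.
move=> ss lt2 lt1; have i_size : (i.+1 < size s)%N.
  by rewrite ltnNge; apply: contraTN lt2 => /(nth_default 0%N) ->.
rewrite count_mem_split // !(count_memPn _) //; apply/negP => /nat_nthP[k].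
  rewrite size_drop nth_drop => _ kE.
  by have := nth_sorted_geq ss (leq_addr k i.+2); rewrite kE; lia.
rewrite size_take i_size => ki; rewrite nth_take // => kE.
by have := nth_sorted_geq ss (ki : (k <= i)%N); rewrite kE; lia.
Qed.

(** The first occurrence of [j] is not in front, as [j] is below the largest part, and it is also
    the last occurrence; gentleness then determines both neighbours. *)
Lemma count1_isolated (s : seq nat) j : sorted geq s -> gentle s ->
    (0 < j < head 0%N s)%N -> count_mem j s = 1%N ->
  exists i, [/\ nth 0%N s i = j.+1, nth 0%N s i.+1 = j & nth 0%N s i.+2 = j.-1]%N.
Proof.
move=> ss gs /andP[j0 jh] cj; have js : j \in s by rewrite -has_pred1 has_count cj.
have := nth_index 0%N js; have := before_find (a := pred1 j) 0%N (s := s).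
have := js; rewrite -index_mem -/(index j s).
case: (index j s) => [|i] i_size bef si; first by move: jh; rewrite -nth0 si ltnn.
exists i; split => //.
  have := bef i (ltnSn i); have := gs i.
  by have := nth_sorted_geq ss (leqnSn i); rewrite /= si; lia.
have : nth 0%N s i.+2 != j.
  apply/eqP => s2; have i2_size : (i.+2 < size s)%N.
    by rewrite ltnNge; apply: contraTN j0 => /(nth_default 0%N) s2'; rewrite -s2 s2'.
  have := count_mem_split i_size; rewrite /= si cj (drop_nth 0%N) //= s2 eqxx; lia.
by have := gs i.+1; have := nth_sorted_geq ss (leqnSn i.+1); rewrite si; lia.
Qed.

(** * Horizontal strips and gaps in a staircase *)

Local Open Scope nat_scope.

Lemma row_shape_of (s : seq nat) i : sorted geq s ->
  row (shape_of (size s).-1 (head 0 s) s) i = nth 0 s i.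
Proof.
move=> ss; case: (ltnP i (size s).-1.+1) => il.
  by rewrite -[i]/(val (Ordinal il)) row_ord shape_ofE.
by rewrite row_out // nth_default // (leq_trans (leqSpred _)).
Qed.

Lemma nat_ivt (f : nat -> nat) m L :
  f 0 <= m <= f L -> (forall t, f t.+1 <= (f t).+1) -> exists t, f t = m.
Proof.
move=> + lip; elim: L => [|L IH] fm; first by exists 0; lia.
case: (leqP m (f L)) => mL; first by apply: IH; lia.
by exists L.+1; have := lip L; lia.
Qed.

Lemma sum_eq_le1 L t : \sum_(r < L) (r == t :> nat) <= 1.
Proof.
suff -> : \sum_(r < L) (r == t :> nat) = (t < L) by case: (_ < _).
elim: L => [|L IH]; first by rewrite big_ord0.
by rewrite big_ord_recr /= IH; case: ltngtP; lia.
Qed.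

Lemma sum_drops (s : seq nat) L : sorted geq s ->
  \sum_(r < L) (nth 0 s r - nth 0 s r.+1) + nth 0 s L = head 0 s.
Proof.
move=> ss; elim: L => [|L IH]; first by rewrite big_ord0 nth0.
by rewrite -IH big_ord_recr /=; have := nth_sorted_geq ss (leqnSn L); lia.
Qed.

(** Row [i] is kept and row [i.+1] is cut to the length of row [i.+2], so two strict drops merge
    into a gap of at least 2. The other rows serve to adjust the size of the strip to [m]. *)
Lemma pieri_strip_gap (rho : seq nat) i m : sorted geq rho -> gentle rho ->
    0 < m < head 0 rho ->
    nth 0 rho i.+2 < nth 0 rho i.+1 -> nth 0 rho i.+1 < nth 0 rho i ->
  exists2 nu : intpart, nu \in pieri_parts rho m & ~ gentle nu.
Proof.
move=> ss gs mlt lt2 lt1; set l := (size rho).-1; set W := head 0 rho.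
(* Besides row [i.+1], the rows before [t] other than [i] are cut to the length of the next row; the
   parameter [t] tunes the size [D t]. *)
pose w t r := if r == i then nth 0 rho r else
  if (r == i.+1) || (r < t) then nth 0 rho r.+1 else nth 0 rho r.
have w_le t r : nth 0 rho r.+1 <= w t r <= nth 0 rho r.
  by have := nth_sorted_geq ss (leqnSn r); rewrite /w; case: ifP => _; [|case: ifP => _]; lia.
pose D t := \sum_(r < l.+1) (nth 0 rho r - w t r).
have size_l : size rho <= l.+1 by rewrite leqSpred.
have [t Dt] : exists t, D t = m.
  apply: (@nat_ivt _ _ l.+1) => [|t].
    apply/andP; split.
      (* For [t = 0] only row [i.+1] is cut, by at most one box. *)
      apply: leq_trans (_ : 1 <= _); last by lia.
      apply: leq_trans _ (sum_eq_le1 l.+1 i.+1); apply: leq_sum => r _.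
      rewrite /w; have := gs r.
      by case: eqP => _; [lia|case: eqP => //= _; lia].
    (* For [t = l.+1] every row but [i] is cut. All the drops telescope to the largest part, and row
       [i] withholds at most one box. *)
    rewrite -ltnS; have {mlt}/andP[_ /leq_trans] := mlt; apply.
    rewrite -(sum_drops l.+1 ss) [nth 0 rho l.+1]nth_default // addn0 -[leqRHS]addn1.
    apply: leq_trans _ (leq_add (leqnn _) (sum_eq_le1 l.+1 i)).
    rewrite -big_split; apply: leq_sum => r _; have := gs r; rewrite /w /= ltn_ord orbT.
    by case: eqP; lia.
  (* Passing from [t] to [t.+1] can change only row [t], by at most one box. *)
  rewrite -[leqRHS]addn1; apply: leq_trans _ (leq_add (leqnn _) (sum_eq_le1 l.+1 t)).
  rewrite -big_split; apply: leq_sum => r _ /=.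
  have := gs r; have := nth_sorted_geq ss (leqnSn r).
  have -> : w t.+1 r = if (r == t :> nat) && (r != i :> nat) then nth 0 rho r.+1 else w t r.
    rewrite /w ltnS [r <= t]leq_eqVlt.
    by case: (r == i :> nat); case: (r == t :> nat); rewrite ?andbF ?orbT.
  by have := w_le t r; case: eqP => _ /=; [case: ifP|]; lia.
pose v : {ffun 'I_l.+1 -> 'I_W.+1} := [ffun r : 'I_l.+1 => inord (w t r)].
have vE r : row v r = w t r.
  case: (ltnP r l.+1) => rl.
    rewrite -[r]/(val (Ordinal rl)) row_ord ffunE inordK //= ltnS.
    case/andP: (w_le t r) => _ /leq_trans; apply.
    by rewrite /W -nth0 nth_sorted_geq.
  rewrite row_out //; apply/esym/eqP; rewrite -leqn0; case/andP: (w_le t r) => _ /leq_trans; apply.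
  by rewrite nth_default // (leq_trans size_l).
have vt : hstrip v (shape_of l W rho) by apply/hstripP => r; rewrite !row_shape_of // vE.
have v_dec := hstrip_dec vt.
exists (Sub (parts_of v) (parts_of_partition v_dec)).
  apply/pieri_partsP; exists v => //; rewrite vt /= -Dt !boxesE -sumnB => [|r _]; last first.
    by rewrite row_shape_of // vE; case/andP: (w_le t r).
  by apply/eqP; apply: eq_bigr => r _; rewrite row_shape_of // vE.
move=> /(_ i); rewrite /= !nth_parts_of // !vE /w !eqxx /=.
by case: eqP => [|_]; lia.
Qed.

(** Interlacing bounds the drop of [v] after row [i] by [rho_i - rho_(i+2)], a sum of two drops of
    at most 1 which are not both strict. *)
Lemma hstrip_gentle (rho : seq nat) (v : {ffun 'I_(size rho).-1.+1 -> 'I_(head 0 rho).+1}) :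
    sorted geq rho -> gentle rho ->
    (forall i, ~ (nth 0 rho i.+2 < nth 0 rho i.+1 < nth 0 rho i)) ->
  hstrip v (shape_of (size rho).-1 (head 0 rho) rho) -> gentle (parts_of v).
Proof.
move=> ss gs no_gap vt i; rewrite !(nth_parts_of (hstrip_dec vt)).
move/hstripP: vt => vt; have := vt i; have := vt i.+1; rewrite !row_shape_of //.
have := no_gap i; have := gs i; have := gs i.+1.
by have := nth_sorted_geq ss (leqnSn i); have := nth_sorted_geq ss (leqnSn i.+1); lia.
Qed.

Theorem theorem4p7 (alpha : seq nat) (m : nat)
    (halpha : is_composition alpha) (hm : 1 <= m < size alpha) :
  sum_of_fat_staircases (delta alpha) [:: m] <->
  (forall j : nat, 1 <= j <= (size alpha).-1 -> 1 < nth 0 alpha j.-1).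
Proof.
have /andP[ss _] := delta_partition alpha; have gs := delta_gentle halpha.
have hd := head_delta halpha.
have [c ec cE] : exists2 c : {fsfun intpart -> int with 0%R},
    schur_expansion (delta alpha) [:: m] c &
    forall nu, c nu = ((nu \in pieri_parts (delta alpha) m)%:R)%R.
  by apply: pieri_expansion => //; rewrite hd; case/andP: hm => _ /ltnW.
split=> [[c' ec' c'0] j j_le | alpha_gt1].
  have j_lt : 0 < j < head 0 (delta alpha) by rewrite hd; lia.
  have a_j : nth 0 alpha j.-1 != 0.
    have j_size : j.-1 < size alpha by lia.
    by apply: contra halpha => /eqP <-; apply: mem_nth.
  rewrite ltn_neqAle lt0n a_j andbT; apply/eqP => a1.
  (* A multiplicity 1 at [j < n] yields the isolated part around which a strip of size [m] opens a
     gap. *)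
  have [|i [i0 i1 i2]] := count1_isolated ss gs j_lt; first by rewrite count_delta; lia.
  have [|||nu nuP nu_gap] := @pieri_strip_gap (delta alpha) i m ss gs; rewrite ?hd //; try lia.
  (* By uniqueness of the expansion, the given coefficients also take the value 1 at [nu]. *)
  have := c'0 nu; rewrite -(schur_expansion_unique ec ec') cE nuP => c0.
  have : ~ fat_staircase nu.
    by case=> b cb nub; apply: nu_gap; rewrite nub; apply: delta_gentle.
  by move/c0/eqP; rewrite GRing.oner_eq0.
exists c => // nu nu_fat; rewrite cE; case: pieri_partsP => // -[v /andP[vt _] nuv].
case: nu_fat; apply: gentle_fat; first exact: (valP nu).
rewrite nuv; apply: hstrip_gentle vt => // i /andP[lt2 lt1].
(* Strict drops on both sides of a part give it multiplicity 1. It is positive and, lying below an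
   earlier part, smaller than n, so [alpha_gt1] applies and is contradicted. *)
have cnt := isolated_count1 ss lt2 lt1; rewrite count_delta in cnt; last by lia.
have := alpha_gt1 (nth 0 (delta alpha) i.+1); rewrite cnt => /(_ _)/notF; apply.
by have := nth_sorted_geq ss (leq0n i); rewrite nth0 hd; lia.
Qed.
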